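(* Let $H=\prod_{i=1}^d[a_i,b_i]\subset\mathbb{R}^d$ be a hyperrectangle. For any continuous function $f\in BMV(H)$, any $\epsilon>0$, any nondecreasing activation function $\sigma:\mathbb{R}\to\mathbb{R}$ for which there are constants $\sigma_-<\sigma_+$ with $\lim_{x\to-\infty}\sigma(x)=\sigma_-$ and $\lim_{x\to\infty}\sigma(x)=\sigma_+$, and any integer $L\ge 3$, there exists a network $\eta:\mathbb{R}^d\to\mathbb{R}$ with an architecture of type (A) with $L$ hidden layers and activation function $\sigma$ satisfying $\|f-\eta\|_\infty=\sup_{x\in H}|f(x)-\eta(x)|\le\epsilon$ and $\operatorname{EMVar}(\eta;H)<\operatorname{MVar}(f;H)$.
   Context: For $x,y\in\mathbb{R}^d$ write $x\le y$ if $x_i\le y_i$ for all $i$; $\odot$ denotes componentwise multiplication. A function $g:\mathbb{R}^d\to\mathbb{R}$ is nondecreasing if $g(x)\le g(y)$ whenever $x\le y$. Let $\{-1,1\}^d=\{s_i: i\in J\}$, $J=\{1,\dots,2^d\}$. A function $f:U\subset\mathbb{R}^d\to\mathbb{R}$ is of bounded M-variation, $f\in BMV(U)$, if there exist nondecreasing $f_i:\mathbb{R}^d\to\mathbb{R}$, $i\in J$, with $f(x)=\sum_{i\in J}f_i(s_i\odot x)$ for all $x\in U$. Its M-variation is $\operatorname{MVar}(f;U)=\inf\sum_{i\in J}\big(\sup_{x\in U}f_i(s_i\odot x)-\inf_{x\in U}f_i(s_i\odot x)\big)$, the infimum being over all such decompositions. A network with architecture of type (A), with $L$ hidden layers and nondecreasing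 activation function $\sigma$, is a map $\eta:\mathbb{R}^d\to\mathbb{R}^N$ of the form $\eta(x)=\sum_{i=1}^K\eta_i(\mathbf{s}_i\odot x)$ with $K\in\mathbb{N}$, $\mathbf{s}_1,\dots,\mathbf{s}_K\in\{-1,1\}^d$ and $$\eta_i(z)=A_{L+1,i}\,\hat\sigma\big(A_{L,i}\,\hat\sigma(\cdots\hat\sigma(A_{1,i}z+b_{1,i})\cdots)+b_{L,i}\big)+b_{L+1,i},$$ where $\hat\sigma$ applies $\sigma$ componentwise, $m_0=d$, $m_{L+1}=N$, $m_1,\dots,m_L\in\mathbb{N}$, all matrices $A_{l,i}\in\mathbb{R}^{m_l\times m_{l-1}}$ ($l=1,\dots,L+1$) have nonnegative entries, and $b_{l,i}\in\mathbb{R}^{m_l}$. Here $N=1$. The estimated M-variation of $\eta$ on $U$ (for the given representation) is $\operatorname{EMVar}(\eta;U)=\sum_{i=1}^K\big(\sup_{x\in U}\eta_i(\mathbf{s}_i\odot x)-\inf_{x\in U}\eta_i(\mathbf{s}_i\odot x)\big)$.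
   Formalization: The strict inequality EMVar(η;H) < MVar(f;H) is claimed only when f is not constant on H; for f constant on H (where MVar(f;H)=0, so strictness is impossible) only EMVar(η;H) ≤ MVar(f;H) is claimed, along with the approximation bound. *)

(* Defs.v *)
From HB Require Import structures.
From mathcomp Require Import all_boot all_order all_algebra.
From mathcomp Require Import all_classical all_reals all_analysis.

Set Implicit Arguments.
Unset Strict Implicit.
Unset Printing Implicit Defensive.

Import Order.TTheory GRing.Theory Num.Theory.
Import numFieldNormedType.Exports.

Local Open Scope classical_set_scope.
Local Open Scope ring_scope.

Definition vle (R : realType) (d : nat) (x y : 'cV[R]_d) : Prop :=
  forall i, x i 0 <= y i 0.

Definition vnondecreasing (R : realType) (d : nat) (g : 'cV[R]_d -> R) : Prop :=
  forall x y, vle x y -> g x <= g y.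

Definition hadamard (R : realType) (d : nat) (x y : 'cV[R]_d) : 'cV[R]_d :=
  map2_mx *%R x y.

(* [signs d] indexes {-1,1}^d: [true] stands for -1 and [false] for 1, so it
   plays the role of the index set J of cardinality 2^d. *)
Definition signs (d : nat) : finType := {ffun 'I_d -> bool}.

Definition sign_vec (R : realType) (d : nat) (s : signs d) : 'cV[R]_d :=
  \col_i (-1) ^+ s i.

Definition flip (R : realType) (d : nat) (s : signs d) (x : 'cV[R]_d)
    : 'cV[R]_d :=
  hadamard (sign_vec R s) x.

Definition hyperrectangle (R : realType) (d : nat) (a b : 'I_d -> R)
    : set 'cV[R]_d :=
  [set x | forall i, a i <= x i 0 <= b i].

(* sup_U g - inf_U g, in the extended reals: +oo when g is unbounded on U
   (only meaningful for nonempty U). *)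
Definition oscillation (R : realType) (d : nat) (U : set 'cV[R]_d)
    (g : 'cV[R]_d -> R) : \bar R :=
  (ereal_sup [set (g x)%:E | x in U] - ereal_inf [set (g x)%:E | x in U])%E.

Definition Mdecomposition (R : realType) (d : nat) (U : set 'cV[R]_d)
    (f : 'cV[R]_d -> R) (F : signs d -> 'cV[R]_d -> R) : Prop :=
  (forall s, vnondecreasing (F s)) /\
  (forall x, U x -> f x = \sum_(s : signs d) F s (flip s x)).

Definition BMV (R : realType) (d : nat) (U : set 'cV[R]_d)
    (f : 'cV[R]_d -> R) : Prop :=
  exists F, Mdecomposition U f F.

Definition MVar (R : realType) (d : nat) (f : 'cV[R]_d -> R)
    (U : set 'cV[R]_d) : \bar R :=
  ereal_inf
    [set (\sum_(s : signs d) oscillation U (fun x => F s (flip s x)))%E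
    | F in [set F | Mdecomposition U f F]].

(* [mono_block R L m n]: the parameters of a map R^m -> R^n with L hidden
   layers, all of whose weight matrices are entrywise nonnegative. [Hidden] puts
   a layer of (positive) width p in front of the remaining ones. *)
Inductive mono_block (R : realType) : nat -> nat -> nat -> Type :=
| Output (m n : nat) (A : 'M[R]_(n, m)) (b : 'cV[R]_n) of
    (forall i j, 0 <= A i j) : mono_block R 0 m n
| Hidden (L m p n : nat) (A : 'M[R]_(p, m)) (b : 'cV[R]_p) of
    (0 < p)%N & (forall i j, 0 <= A i j) & mono_block R L p n :
    mono_block R L.+1 m n.

Fixpoint block_eval (R : realType) (sigma : R -> R) (L m n : nat)
    (B : mono_block R L m n) : 'cV[R]_m -> 'cV[R]_n :=
  match B with
  | Output _ _ A b _ => fun z => A *m z + b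
  | Hidden _ _ _ _ A b _ _ B' =>
      fun z => block_eval sigma B' (map_mx sigma (A *m z + b))
  end.

Record networkA (R : realType) (L d N : nat) := NetworkA {
  net_size : nat;
  net_size_gt0 : (0 < net_size)%N;
  net_sign : 'I_net_size -> signs d;
  net_block : 'I_net_size -> mono_block R L d N
}.

Definition net_summand (R : realType) (sigma : R -> R) (L d N : nat)
    (eta : networkA R L d N) (i : 'I_(net_size eta)) (x : 'cV[R]_d)
    : 'cV[R]_N :=
  block_eval sigma (net_block i) (flip (net_sign i) x).

Definition net_eval (R : realType) (sigma : R -> R) (L d N : nat)
    (eta : networkA R L d N) (x : 'cV[R]_d) : 'cV[R]_N :=
  \sum_(i < net_size eta) net_summand sigma i x.

Definition EMVar (R : realType) (sigma : R -> R) (L d : nat)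
    (eta : networkA R L d 1) (U : set 'cV[R]_d) : \bar R :=
  (\sum_(i < net_size eta)
     oscillation U (fun x => net_summand sigma i x 0 0)%R)%E.

(* Main.v *)
Require Import Defs.
From HB Require Import structures.
From mathcomp Require Import all_boot all_order all_algebra.
From mathcomp Require Import all_classical all_reals all_analysis.
From mathcomp Require Import ring lra.

Set Implicit Arguments.
Unset Strict Implicit.
Unset Printing Implicit Defensive.

Import Order.TTheory GRing.Theory Num.Theory.
Import numFieldNormedType.Exports.

Local Open Scope classical_set_scope.
Local Open Scope ring_scope.

(** The difficulty is that the components of a decomposition
    f x = \sum_s F s (flip s x) may jump even though f is continuous, and a
    jump cannot be approximated uniformly by networks without control on where
    it sits.  Averaging removes the jumps without increasing the variation.
    After extending everything to the whole space by composing with the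
    projection [clamp] onto the box, replace every F s by its mean over small
    translations x + h * k * s' (k < N), taken successively in all the diagonal
    directions s'.  Since the same translations are used for every component,
    the averaged components still add up to an average of f, which is
    uniformly close to f because f is uniformly continuous
    ([box_uniformly_continuous]).  The averages are still monotone and stay in
    the range of F s, and averaging along the direction s telescopes: moving by
    h * s changes the average of F s by at most (range of F s) / N, because
    only the two end terms of the sum over k survive ([smooth_step]).  So every
    averaged component g is almost continuous at the scale h
    ([smooth_decomposition]).

    Such a g is then approximated by a three-layer network
    ([monotone_network]).  A superlevel set of g is, up to the scale h, a
    finite union of quadrants with corner p in a grid, that is a monotone
    formula: OR over p, of AND over i, of (p_i <= z_i).  The three hidden layers
    evaluate the comparisons, the conjunctions and the disjunctions
    ([dnf_network]), and the output layer adds up equally spaced levels.  All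
    gates take values in [0, 1] up to an affine change, so the output never
    leaves the range [m, M] of g, whatever happens in the transition zones of
    the gates.  Further hidden layers only sharpen the truth values
    ([robust_sum]).

    This gives networks that are uniformly close to f with estimated variation
    at most the total oscillation of any prescribed decomposition
    ([network_of_decomposition]).  The strict inequality comes from applying
    this to (1 - theta) f with theta small: the variation is multiplied by
    1 - theta while f moves by at most theta * sup |f|, and when f is not
    constant MVar is positive, so some decomposition has total oscillation less
    than MVar / (1 - theta). *)

(** * Summing equally spaced levels *)

(** The sum is t rounded down to a multiple of w; the bound on t in the second
    part says that K levels suffice to reach it. *)
Lemma staircase (R : realType) (K : nat) (w t : R) : 0 <= w -> 0 <= t ->
  \sum_(k < K) (if w * k.+1%:R <= t then w else 0) <= t /\
  (t <= w * K.+1%:R ->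
   t - w <= \sum_(k < K) (if w * k.+1%:R <= t then w else 0)).
Proof.
move=> w0 t0; elim: K => [|K [IHhi IHlo]].
  by rewrite big_ord0 mulr1; split=> //; lra.
rewrite big_ord_recr /=; case: ifP => [Kt|/negbT]; last first.
  by rewrite -ltNge => tK; rewrite addr0; split=> // _; apply/IHlo/ltW.
have -> : \sum_(k < K) (if w * k.+1%:R <= t then w else 0) + w = w * K.+1%:R.
  rewrite (eq_bigr (fun=> w)) => [|k _].
    by rewrite sumr_const card_ord -mulrSr mulr_natr.
  by rewrite (le_trans _ Kt) // ler_wpM2l // ler_nat ltnS ltnW.
by split=> //; rewrite [_%:R in X in X -> _]mulrSr mulrDr mulr1; lra.
Qed.

(** * Gates and realizable output stages *)

Section MonotoneNetworks.
Context (R : realType) (sigma : R -> R).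
Context (hsigma : {homo sigma : x y / x <= y}).
Context (sm sp : R) (hsmp : sm < sp).
Context (hsm : sigma x @[x --> -oo] --> sm).
Context (hsp : sigma x @[x --> +oo] --> sp).

(** The activation rescaled to have limits 0 and 1.  Working with [gate] costs
    nothing, since the increasing affine change between [gate] and [sigma] can
    be absorbed in the weights and biases of the next layer. *)
Definition gate (t : R) : R := (sigma t - sm) / (sp - sm).

Lemma sigma_gate t : sigma t = sm + (sp - sm) * gate t.
Proof.
have D0 : sp - sm != 0 by rewrite subr_eq0 gt_eqF.
by rewrite /gate mulrC divfK // addrC subrK.
Qed.

Lemma gate_itv t : 0 <= gate t <= 1.
Proof.
have D0 : 0 < sp - sm by rewrite subr_gt0.
have lo : sm <= sigma t.
  apply: (cvgr_to_le hsm); exists t; split; first exact: num_real.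
  by move=> x /ltW/hsigma.
have hi : sigma t <= sp.
  apply: (cvgr_to_ge hsp); exists t; split; first exact: num_real.
  by move=> x /ltW/hsigma.
by rewrite divr_ge0 ?ler_pdivrMr ?mul1r ?lerD2r ?subr_ge0 // ltW.
Qed.

(** A large input weight l makes the gate an approximate Heaviside step, with
    error delta outside the transition zone ]-rho, rho[. *)
Lemma gate_sharp (delta rho : R) : 0 < delta -> 0 < rho ->
  exists l, 0 <= l /\ forall t,
    (rho <= t -> 1 - delta <= gate (l * t)) /\
    (t <= - rho -> gate (l * t) <= delta).
Proof.
move=> d0 r0; have D0 : 0 < sp - sm by rewrite subr_gt0.
have dD : 0 < delta * (sp - sm) by rewrite mulr_gt0.
have [M [_ HM]] : \forall x \near +oo, sp - delta * (sp - sm) < sigma x.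
  by apply: (cvgr_gt _ hsp); rewrite ltrBlDr ltrDl.
have [N [_ HN]] : \forall x \near -oo, sigma x < sm + delta * (sp - sm).
  by apply: (cvgr_lt _ hsm); rewrite ltrDl.
pose K := `|M| + `|N| + 1.
have K0 : 0 < K by rewrite ltr_wpDl ?addr_ge0.
have lM := ler_norm M; have lN := ler_norm (- N); rewrite normrN in lN.
have nM := normr_ge0 M; have nN := normr_ge0 N.
exists (K / rho); split=> [|t]; first by rewrite divr_ge0 ?ltW.
have K_rho : K / rho * rho = K by rewrite divfK ?gt_eqF.
have Kr0 : 0 < K / rho by rewrite divr_gt0.
split=> ht.
- have Kt : K <= K / rho * t by rewrite -{1}K_rho ler_pM2l.
  have /HM/ltW : M < K / rho * t by move: Kt; rewrite /K; lra.
  by rewrite /gate ler_pdivlMr //; lra.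
- have Kt : K / rho * t <= - K by rewrite -{2}K_rho -mulrN ler_pM2l.
  have /HN/ltW : K / rho * t < N by move: Kt; rewrite /K; lra.
  by rewrite /gate ler_pdivrMr //; lra.
Qed.

(** phi is computed by a stage with L further hidden layers placed on top of
    a layer of gates indexed by T.  The units of that layer carry the values
    sm + (sp - sm) * u t of [sigma], whereas phi is expressed in terms of the
    gate values u t.  Since a block is built from its output end, stages are
    composed by adding layers in front, and finite types as index sets avoid
    numbering the units. *)
Definition readout (L : nat) (T : finType) (phi : (T -> R) -> R) : Prop :=
  exists B : mono_block R L #|T| 1, forall u : T -> R,
    block_eval sigma B (\col_i (sm + (sp - sm) * u (enum_val i))) 0 0 = phi u.

Lemma affine_normalized (T : finType) (w u : T -> R) (c : R) :
  \sum_(j < #|T|) w (enum_val j) / (sp - sm)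
      * (sm + (sp - sm) * u (enum_val j))
    + (c - \sum_t w t / (sp - sm) * sm)
  = \sum_t w t * u t + c.
Proof.
have D0 : sp - sm != 0 by rewrite subr_eq0 gt_eqF.
have -> : \sum_(j < #|T|) w (enum_val j) / (sp - sm)
    * (sm + (sp - sm) * u (enum_val j))
    = \sum_t w t / (sp - sm) * (sm + (sp - sm) * u t).
  rewrite -(big_enum_val (fun t : T =>
    w t / (sp - sm) * (sm + (sp - sm) * u t))).
  exact: eq_bigl.
rewrite addrCA addrC -sumrB; congr (_ + _); apply: eq_bigr => t _.
by field; rewrite D0.
Qed.

Lemma readout_output (T : finType) (w : T -> R) (c : R) :
  (forall t, 0 <= w t) -> readout 0 (fun u => \sum_t w t * u t + c).
Proof.
move=> w0; have D0 : 0 < sp - sm by rewrite subr_gt0.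
have A0 : forall i j,
    0 <= (\matrix_(i < 1, j < #|T|) (w (enum_val j) / (sp - sm))) i j.
  by move=> i j; rewrite mxE divr_ge0 ?(ltW D0).
exists (Output (const_mx (c - \sum_t w t / (sp - sm) * sm)) A0) => u /=.
rewrite !mxE -[RHS]affine_normalized; congr (_ + _).
by apply: eq_bigr => j _; rewrite !mxE.
Qed.

Lemma readout_hidden (L : nat) (S T : finType) (phi : (S -> R) -> R)
    (W : S -> T -> R) (b : S -> R) :
  (0 < #|S|)%N -> (forall s t, 0 <= W s t) -> readout L phi ->
  readout L.+1 (fun u => phi (fun s => gate (\sum_t W s t * u t + b s))).
Proof.
move=> S0 W0 [B HB]; have D0 : 0 < sp - sm by rewrite subr_gt0.
have A0 : forall i j, 0 <= (\matrix_(i < #|S|, j < #|T|)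
    (W (enum_val i) (enum_val j) / (sp - sm))) i j.
  by move=> i j; rewrite mxE divr_ge0 ?(ltW D0).
exists (Hidden (\col_i (b (enum_val i)
  - \sum_t W (enum_val i) t / (sp - sm) * sm)) S0 A0 B) => u /=.
rewrite -HB; congr (block_eval _ _ _ _ _); apply/matrixP => i j.
rewrite !mxE sigma_gate -(affine_normalized (W (enum_val i))).
congr (_ + _ * gate (_ + _)).
by apply: eq_bigr => k _; rewrite !mxE ?(ord1 j).
Qed.

Lemma block_of_readout (L d : nat) (S : finType) (phi : (S -> R) -> R)
    (W : S -> 'I_d -> R) (b : S -> R) :
  (0 < #|S|)%N -> (forall s i, 0 <= W s i) -> readout L phi ->
  exists B : mono_block R L.+1 d 1, forall z : 'cV[R]_d,
    block_eval sigma B z 0 0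
    = phi (fun s => gate (\sum_i W s i * z i 0 + b s)).
Proof.
move=> S0 W0 [B HB].
have A0 : forall i j, 0 <= (\matrix_(i < #|S|, j < d) W (enum_val i) j) i j.
  by move=> i j; rewrite mxE.
exists (Hidden (\col_i b (enum_val i)) S0 A0 B) => z /=.
rewrite -HB; congr (block_eval _ _ _ _ _); apply/matrixP => i j.
rewrite !mxE sigma_gate; congr (_ + _ * gate (_ + _)).
by apply: eq_bigr => k _; rewrite !mxE ?(ord1 j).
Qed.

Lemma sum_delta (T : finType) (s : T) (l : R) (u : T -> R) :
  \sum_t (if t == s then l else 0) * u t = l * u s.
Proof.
rewrite (bigD1 s) //= eqxx big1 ?addr0 // => t /negPf ->.
by rewrite mul0r.
Qed.

(** A weighted sum of approximate truth values, of any depth.  Each extra layer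
    compares the values with 1/2, which resets their error to the accuracy
    required by the layers above; so an arbitrary depth is obtained at no cost
    in precision. *)
Lemma robust_sum (L : nat) (T : finType) (w c delta : R) :
  (0 < #|T|)%N -> 0 <= w -> 0 < delta ->
  exists delta' phi, [/\ 0 < delta', readout L phi &
    forall u : T -> R, (forall k, 0 <= u k <= 1) ->
    exists v : T -> R, phi u = \sum_k w * v k + c /\
      forall k, [/\ 0 <= v k <= 1, 1 - delta' <= u k -> 1 - delta <= v k &
                    u k <= delta' -> v k <= delta]].
Proof.
move=> T0 w0 d0; elim: L => [|L [d' [phi [d'0 rphi Hphi]]]].
  exists delta, (fun u => \sum_k w * u k + c); split=> //.
    exact: readout_output.
  by move=> u u01; exists u.
have q0 : 0 < 4^-1 :> R by lra.
have [l [l0 Hl]] := gate_sharp d'0 q0.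
exists 4^-1, (fun u => phi (fun s =>
  gate (\sum_t (if t == s then l else 0) * u t + - (l / 2)))); split=> //.
  apply: (@readout_hidden _ _ _ _ (fun s t => if t == s then l else 0)
    (fun=> - (l / 2))) => // s t.
  by case: ifP.
move=> u u01.
have [v [-> Hv]] := Hphi _ (fun s => gate_itv
  (\sum_t (if t == s then l else 0) * u t + - (l / 2))).
exists v; split=> // k; have [v01 vhi vlo] := Hv k.
have E : \sum_t (if t == k then l else 0) * u t + - (l / 2) = l * (u k - 2^-1).
  by rewrite sum_delta; field.
rewrite E in vhi vlo; split=> // uk.
- by apply: vhi; apply: (Hl _).1; lra.
- by apply: vlo; apply: (Hl _).2; lra.
Qed.

(** * Conjunctions and disjunctions as threshold gates *)

(** A conjunction compares the sum of its n inputs with n - 1/2, a disjunction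
    compares it with 1/2.  With precise enough inputs the sum stays at distance
    1/4 from the threshold, outside the transition zone of the next gate. *)
Lemma conj_sum_hi (I : finType) (u : I -> R) (delta : R) :
  #|I|%:R * delta <= 4^-1 -> (forall i, 1 - delta <= u i) ->
  4^-1 <= \sum_i u i - (#|I|%:R - 2^-1).
Proof.
move=> hd hu.
have : \sum_(i : I) (1 - delta) <= \sum_i u i by apply: ler_sum.
by rewrite sumr_const mulrnBl -(mulr_natl delta); set n := _%:R; lra.
Qed.

Lemma conj_sum_lo (I : finType) (u : I -> R) (i0 : I) :
  (forall i, u i <= 1) -> u i0 <= 4^-1 ->
  \sum_i u i - (#|I|%:R - 2^-1) <= - 4^-1.
Proof.
move=> u1 ui0.
have : \sum_i u i <= \sum_i (1 - (if i == i0 then 3 / 4 else 0)).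
  by apply: ler_sum => i _; case: eqP => [->|_]; [lra|rewrite subr0].
rewrite sumrB -big_mkcond big_pred1_eq sumr_const -[1 *+ _]/(_%:R : R).
by set n := _%:R; lra.
Qed.

Lemma disj_sum_hi (I : finType) (A : {set I}) (v : I -> R) (p : I) :
  (forall i, 0 <= v i) -> p \in A -> 3 / 4 <= v p ->
  4^-1 <= \sum_(i in A) v i - 2^-1.
Proof.
move=> v0 pA vp; rewrite (bigD1 p) //=.
have : 0 <= \sum_(i in A | i != p) v i by apply: sumr_ge0.
lra.
Qed.

Lemma disj_sum_lo (I : finType) (A : {set I}) (v : I -> R) (delta : R) :
  0 <= delta -> #|I|%:R * delta <= 4^-1 ->
  (forall i, i \in A -> v i <= delta) ->
  \sum_(i in A) v i - 2^-1 <= - 4^-1.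
Proof.
move=> d0 hd hv.
have : \sum_(i in A) v i <= \sum_(i in A) delta by apply: ler_sum.
rewrite sumr_const -(mulr_natl delta).
have : #|A|%:R * delta <= #|I|%:R * delta.
  by apply: ler_wpM2r => //; rewrite ler_nat max_card.
lra.
Qed.

(** * Networks approximating monotone functions *)

(** v k is the approximate truth value of the monotone formula
    OR_(p in A k) AND_i (pt p i <= z i); nothing is claimed when some
    comparison is undecided at the scale h, except 0 <= v k <= 1. *)
Lemma dnf_network (L d : nat) (P T : finType) (pt : P -> 'cV[R]_d)
    (A : T -> {set P}) (h delta w c : R) :
  (0 < d)%N -> (0 < #|P|)%N -> (0 < #|T|)%N -> 0 < h -> 0 < delta -> 0 <= w ->
  exists B : mono_block R L.+3 d 1, forall z : 'cV[R]_d, exists v : T -> R,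
    block_eval sigma B z 0 0 = \sum_k w * v k + c /\
    forall k, [/\ 0 <= v k <= 1,
      (exists2 p, p \in A k & forall i, pt p i 0 + h <= z i 0) ->
        1 - delta <= v k &
      (forall p, p \in A k -> exists i, z i 0 <= pt p i 0 - h) ->
        v k <= delta].
Proof.
move=> d0 P0 T0 h0 delta0 w0; have q0 : 0 < 4^-1 :> R by lra.
(* The accuracies are chosen from the output layer backwards, each layer
   being sharp enough for the number of inputs of the one above. *)
have [d3 [phi [d30 rphi Hphi]]] := robust_sum L c T0 w0 delta0.
have [l3 [l30 H3]] := gate_sharp d30 q0.
have P0R : 0 < #|P|%:R :> R by rewrite ltr0n.
have d0R : 0 < #|'I_d|%:R :> R by rewrite card_ord ltr0n.
pose d2 : R := 4^-1 / #|P|%:R; have d20 : 0 < d2 by rewrite divr_gt0.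
have [l2 [l20 H2]] := gate_sharp d20 q0.
pose d1 : R := 4^-1 / #|'I_d|%:R; have d10 : 0 < d1 by rewrite divr_gt0.
have [l1 [l10 H1]] := gate_sharp d10 h0.
have d2P : #|P|%:R * d2 = 4^-1 by rewrite mulrC divfK ?gt_eqF.
have d1d : #|'I_d|%:R * d1 = 4^-1 by rewrite mulrC divfK ?gt_eqF.
have d14 : d1 <= 4^-1.
  rewrite /d1 ler_pdivrMr // ler_peMr ?(ltW q0) //.
  by rewrite card_ord ler1n.
have d24 : d2 <= 4^-1.
  by rewrite /d2 ler_pdivrMr // ler_peMr ?(ltW q0) // ler1n.
have PI0 : (0 < #|{: P * 'I_d}|)%N.
  by rewrite card_prod card_ord muln_gt0 P0.
have if0 (c' : bool) (l : R) : 0 <= l -> 0 <= (if c' then l else 0).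
  by case: c'.
have r3 := @readout_hidden L T P phi (fun k p => if p \in A k then l3 else 0)
  (fun=> - (l3 / 2)) T0 (fun _ _ => if0 _ _ l30) rphi.
have r2 := @readout_hidden _ P (P * 'I_d)%type _
  (fun p t => if t.1 == p then l2 else 0)
  (fun=> - (l2 * (#|'I_d|%:R - 2^-1))) P0 (fun _ _ => if0 _ _ l20) r3.
have [B HB] := @block_of_readout _ d (P * 'I_d)%type _
  (fun t i => if i == t.2 then l1 else 0) (fun t => - (l1 * pt t.1 t.2 0))
  PI0 (fun _ _ => if0 _ _ l10) r2.
exists B => z.
pose u p i := gate (l1 * (z i 0 - pt p i 0)).
pose a p := gate (l2 * (\sum_i u p i - (#|'I_d|%:R - 2^-1))).
pose o k := gate (l3 * (\sum_(p in A k) a p - 2^-1)).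
have -> : block_eval sigma B z 0 0 = phi o.
  rewrite HB; congr phi; apply/funext => k; congr gate.
  rewrite [RHS]mulrBr; congr (_ - _).
  rewrite big_distrr [RHS]big_mkcond /=; apply: eq_bigr => p _.
  case: ifP => _; rewrite ?mul0r //; congr (_ * gate _).
  rewrite [RHS]mulrBr; congr (_ - _).
  rewrite -(pair_bigA _ (fun q i => (if q == p then l2 else 0) *
    gate (\sum_j (if j == i then l1 else 0) * z j 0 + - (l1 * pt q i 0)))) /=.
  rewrite -(sum_delta p l2 (fun q => \sum_i u q i)).
  apply: eq_bigr => q _; rewrite big_distrr /=.
  by apply: eq_bigr => i _; rewrite sum_delta -mulrBr.
have [v [-> Hv]] := Hphi _ (fun k => gate_itv
  (l3 * (\sum_(p in A k) a p - 2^-1))).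
exists v; split=> // k; have [v01 vhi vlo] := Hv k.
have a01 p : 0 <= a p by have /andP[] := gate_itv
  (l2 * (\sum_i u p i - (#|'I_d|%:R - 2^-1))).
have u1 p i : u p i <= 1 by have /andP[] := gate_itv
  (l1 * (z i 0 - pt p i 0)).
split=> // [[p pA pz]|Az].
- apply: vhi; apply: (H3 _).1; apply: (disj_sum_hi _ pA) => //.
  suff : 1 - d2 <= a p by lra.
  apply: (H2 _).1; apply: (@conj_sum_hi _ _ d1); first by rewrite d1d.
  by move=> i; apply: (H1 _).1; have := pz i; lra.
- apply: vlo; apply: (H3 _).2; apply: (@disj_sum_lo _ _ _ d2).
  + exact: ltW.
  + by rewrite d2P.
  + move=> p /Az[i zi]; apply: (H2 _).2; apply: (@conj_sum_lo _ _ i) => //.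
    by apply: le_trans d14; apply: (H1 _).2; lra.
Qed.

(** The levels of g are sampled at the points of a grid of mesh h.  If z lies in
    the box, some grid point lies between z - 2h and z - h, so the formula for
    the level c holds as soon as c <= g (z - 2h); and it fails, with margin h,
    as soon as g (z + h) < c.  The output is therefore squeezed between
    g (z - 2h) and g (z + h), which the hypothesis on the steps of g puts within
    2 omega of g z.  The range of the output is exactly that of g: this is what
    keeps the estimated variation under control. *)
Lemma monotone_network (L d : nat) (g : 'cV[R]_d -> R) (m M r h eps omega : R) :
  (0 < d)%N -> vnondecreasing g -> (forall z, m <= g z <= M) ->
  0 < h -> 0 < eps ->
  (forall z, g (z + const_mx h) - g z <= omega) ->
  exists B : mono_block R L.+3 d 1,
    (forall z : 'cV[R]_d, m <= block_eval sigma B z 0 0 <= M) /\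
    (forall z : 'cV[R]_d, (forall i, `|z i 0| <= r) ->
       `|block_eval sigma B z 0 0 - g z| <= 2 * omega + eps).
Proof.
move=> d0 gmono gmM h0 eps0 gomega.
have mM : m <= M by have /andP[m0 M0] := gmM 0; exact: le_trans m0 M0.
pose V := M - m; have V0 : 0 <= V by rewrite subr_ge0.
pose K := (Num.truncn (2 * V / eps)).+1.
pose w := V / K%:R; have w0 : 0 <= w by rewrite divr_ge0.
have wK : w * K%:R = V by rewrite /w divfK // pnatr_eq0.
have weps : w <= eps / 2.
  have : 2 * V / eps <= K%:R by rewrite ltW // truncnS_gt.
  by rewrite /w ler_pdivrMr ?ltr0n // ler_pdivrMr //; lra.
pose delta := eps / (2 * (V + 1)).
have delta0 : 0 < delta by rewrite divr_gt0 // mulr_gt0 // ltr_wpDl.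
have Vdelta : V * delta <= eps / 2.
  have -> : eps / 2 = (V + 1) * delta.
    by rewrite /delta; field; rewrite gt_eqF // ltr_wpDl.
  by rewrite ler_wpM2r ?ltW // ltrDl.
(* The grid starts at - r - 2h, so that it has points below z - h for every z
   in the box. *)
pose n := Num.truncn (2 * r / h).
pose P : finType := {ffun 'I_d -> 'I_n.+2}.
pose pt (p : P) : 'cV[R]_d := \col_i (h * (p i)%:R - r - 2 * h).
pose A (k : 'I_K) : {set P} := [set p | w * k.+1%:R <= g (pt p) - m]%SET.
have P0 : (0 < #|P|)%N by apply/card_gt0P; exists [ffun=> ord0].
have K0 : (0 < #|'I_K|)%N by rewrite card_ord.
have [B HB] := @dnf_network L d P 'I_K pt A h delta w m d0 P0 K0 h0 delta0 w0.
exists B; split=> z; have [v [-> Hv]] := HB z.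
  have lo : 0 <= \sum_k w * v k.
    by apply: sumr_ge0 => k _; have [/andP[v0 _] _ _] := Hv k; rewrite mulr_ge0.
  have hi : \sum_k w * v k <= V.
    rewrite -wK mulr_natr -[X in _ *+ X]card_ord -sumr_const.
    apply: ler_sum => k _; have [/andP[_ v1] _ _] := Hv k.
    by rewrite ler_piMr.
  by move: hi; rewrite /V; lra.
move=> zr.
pose al := g (z - const_mx h - const_mx h); pose be := g (z + const_mx h).
have al_g : g z <= al + 2 * omega.
  have := gomega (z - const_mx h - const_mx h); have := gomega (z - const_mx h).
  by rewrite !subrK /al; lra.
have be_g : be <= g z + omega by have := gomega z; rewrite /be; lra.
have hi (k : 'I_K) : w * k.+1%:R <= al - m -> 1 - delta <= v k.
  move=> kal; have [_ + _] := Hv k; apply.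
  have jP i : ((Num.truncn ((z i 0 + r) / h)%R).+1 < n.+2)%N.
    rewrite !ltnS; apply: le_truncn; rewrite ler_pM2r ?invr_gt0 //.
    by have := zr i; rewrite ler_norml; lra.
  pose p : P := [ffun i => Ordinal (jP i)].
  have pti i : z i 0 - 2 * h <= pt p i 0 <= z i 0 - h.
    rewrite mxE ffunE /=; set j := Num.truncn _.
    have /truncn_itv : 0 <= (z i 0 + r) / h.
      by rewrite divr_ge0 ?(ltW h0) //; have := zr i; rewrite ler_norml; lra.
    rewrite -/j ler_pdivlMr // ltr_pdivrMr // mulrSr.
    by rewrite !mulrDl !mulrDr !mulr1 !mul1r mulrC; lra.
  exists p; last by move=> i; have := pti i; lra.
  rewrite inE (le_trans kal) // lerD2r; apply: gmono => i.
  by have := pti i; rewrite !mxE; lra.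
have lo (k : 'I_K) : be - m < w * k.+1%:R -> v k <= delta.
  move=> kbe; have [_ _] := Hv k; apply=> p; rewrite inE => kp.
  apply/existsP; apply: contraLR kbe => /existsPn pz.
  rewrite -leNgt (le_trans kp) // lerD2r; apply: gmono => i.
  by have := pz i; rewrite -ltNge !mxE; lra.
have /andP[al_m _] := gmM (z - const_mx h - const_mx h).
have /andP[be_m be_M] := gmM (z + const_mx h).
have al0 : 0 <= al - m by rewrite subr_ge0.
have be0 : 0 <= be - m by rewrite subr_ge0.
have [_ stlo] := staircase K w0 al0.
have [sthi _] := staircase K w0 be0.
have sumw : \sum_(k < K) w * delta = V * delta.
  by rewrite -mulr_suml sumr_const card_ord -mulr_natr wK.
have lower : al - m - w - V * delta <= \sum_k w * v k.
  apply: (@le_trans _ _ (\sum_(k < K)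
      ((if w * k.+1%:R <= al - m then w else 0) - w * delta))).
    rewrite sumrB sumw lerD2r; apply: stlo.
    rewrite mulrSr mulrDr wK mulr1.
    have /andP[_] := gmM (z - const_mx h - const_mx h).
    by rewrite -/al /V; lra.
  apply: ler_sum => k _; have [/andP[v0 _] _ _] := Hv k; case: ifP => kal.
    by rewrite -{1}[w]mulr1 -mulrBr ler_wpM2l // hi.
  by rewrite sub0r (@le_trans _ _ 0) // ?oppr_le0 mulr_ge0 // ltW.
have upper : \sum_k w * v k <= be - m + V * delta.
  apply: (@le_trans _ _ (\sum_(k < K)
      ((if w * k.+1%:R <= be - m then w else 0) + w * delta))).
    apply: ler_sum => k _; have [/andP[v0 v1] _ _] := Hv k; case: ifP => kbe.
      apply: ler_wpDr; first by rewrite mulr_ge0 // ltW.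
      by rewrite ler_piMr.
    by rewrite add0r ler_wpM2l // lo // ltNge kbe.
  by rewrite big_split /= sumw lerD2r.
rewrite ler_norml; move: lower upper al_g be_g weps Vdelta eps0.
set S := \sum_k _; set W := V * delta.
have om0 : 0 <= omega.
  have := gomega z; suff : g z <= g (z + const_mx h) by lra.
  by apply: gmono => i; rewrite !mxE; lra.
lra.
Qed.

End MonotoneNetworks.

(** * Uniform continuity on a box *)

(** Heine-Cantor: near every point of the box continuity gives a radius that
    works for a whole neighbourhood, and compactness makes it uniform.  The box
    is compact as a product of segments, that is as a set of row vectors, hence
    the transpositions. *)
Lemma box_uniformly_continuous (R : realType) (d : nat) (a b : 'I_d -> R)
    (f : 'cV[R]_d -> R) (eps : R) :
  {within hyperrectangle a b, continuous f} -> 0 < eps ->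
  exists rho, 0 < rho /\ forall x y,
    hyperrectangle a b x -> hyperrectangle a b y ->
    (forall i, `|x i 0 - y i 0| <= rho) -> `|f x - f y| <= eps.
Proof.
move=> /subspace_continuousP fc eps0; have e20 : 0 < eps / 2 by lra.
have cK : compact [set v : 'rV[R]_d | forall i, `[a i, b i]%classic (v ord0 i)].
  by apply: (@rV_compact R d (fun i => `[a i, b i]%classic)) => i;
    exact: segment_compact.
have KH (v : 'rV[R]_d) : (forall i, `[a i, b i]%classic (v ord0 i)) ->
    hyperrectangle a b v^T.
  by move=> Kv i; have := Kv i; rewrite /= in_itv /= mxE.
move/compact_near_coveringP/near_covering_withinP : cK.
move=> /(_ R (0^'+) (fun rho v => forall y, hyperrectangle a b y ->
  (forall i, `|v^T i 0 - y i 0| <= rho) -> `|f v^T - f y| <= eps) _) cov.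
have {}cov := cov _.
have [|rho [rho0 Hrho]] := @filter_ex _ (0^'+ : set_system R) _ _
    (filterI (nbhs_right_gt (0 : R)) (cov _)).
- move=> v /KH Hv.
  have /cvgr_dist_lt/(_ _ e20) := fc _ Hv.
  rewrite /within /= => /nbhs_ballP[e /= e0 He].
  exists (ball v (e / 2), [set rho : R | rho < e / 2]).
    split => /=; first by apply: nbhsx_ballx; lra.
    by apply: nbhs_right_lt; lra.
  move=> [v' rho] /= [[_ vv'] rhoe] /KH Hv' y Hy v'y.
  have e2 : 0 < e / 2 by lra.
  have near_v z : hyperrectangle a b z ->
      (forall i, `|v^T i 0 - z i 0| < e) -> `|f v^T - f z| < eps / 2.
    move=> Hz vz; apply: He => //; split=> // i j.
    by rewrite ord1; exact: vz.
  have vv i : `|v^T i 0 - v'^T i 0| < e / 2.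
    by rewrite !mxE; exact: vv'.
  have : `|f v^T - f v'^T| < eps / 2.
    by apply: near_v => // i; apply: lt_trans (vv i) _; lra.
  have : `|f v^T - f y| < eps / 2.
    apply: near_v => // i.
    have -> : v^T i 0 - y i 0 = (v^T i 0 - v'^T i 0) + (v'^T i 0 - y i 0).
      by lra.
    by apply: le_lt_trans (ler_normD _ _) _; have := vv i; have := v'y i; lra.
  by rewrite !ltr_norml ler_norml; lra.
exists rho; split=> // x y Hx Hy xy.
have := Hrho x^T _ y Hy; rewrite trmxK; apply=> //.
by move=> i; rewrite /= in_itv /= mxE; exact: Hx.
Qed.

(** * Projection onto a box, and reflections *)

Definition clamp (R : realType) (d : nat) (a b : 'I_d -> R) (x : 'cV[R]_d)
    : 'cV[R]_d :=
  \col_i Num.max (a i) (Num.min (b i) (x i 0)).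

Lemma clamp_box (R : realType) (d : nat) (a b : 'I_d -> R) (x : 'cV[R]_d) :
  (forall i, a i <= b i) -> hyperrectangle a b (clamp a b x).
Proof.
move=> ab i; rewrite mxE le_max lexx /= ge_max ab /=.
by rewrite ge_min lexx.
Qed.

Lemma clamp_id (R : realType) (d : nat) (a b : 'I_d -> R) (x : 'cV[R]_d) :
  hyperrectangle a b x -> clamp a b x = x.
Proof.
move=> Hx; apply/colP => i; rewrite mxE; have /andP[ax xb] := Hx i.
by rewrite min_r // max_r.
Qed.

Lemma clamp_le (R : realType) (d : nat) (a b : 'I_d -> R) (x y : 'cV[R]_d) i :
  x i 0 <= y i 0 -> clamp a b x i 0 <= clamp a b y i 0.
Proof. by move=> xy; rewrite !mxE; apply: le_max2; last apply: le_min2. Qed.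

Lemma clamp_lipschitz (R : realType) (d : nat) (a b : 'I_d -> R)
    (x y : 'cV[R]_d) i :
  `|clamp a b x i 0 - clamp a b y i 0| <= `|x i 0 - y i 0|.
Proof.
wlog yx : x y / y i 0 <= x i 0.
  move=> H; case: (leP (y i 0) (x i 0)) => [/H//|/ltW/H].
  by rewrite distrC (distrC (y i 0)).
rewrite !ger0_norm ?subr_ge0 ?clamp_le // !mxE.
case: (leP (b i) (x i 0)) => ?; case: (leP (b i) (y i 0)) => ?;
case: (leP (a i) (b i)) => ?; case: (leP (a i) (x i 0)) => ?;
case: (leP (a i) (y i 0)) => ?; lra.
Qed.

Lemma flipE (R : realType) (d : nat) (s : signs d) (x : 'cV[R]_d) i j :
  flip s x i j = if s i then - x i j else x i j.
Proof.
by rewrite /flip /hadamard !mxE ord1; case: (s i); rewrite ?mulN1r ?mul1r.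
Qed.

Lemma flipK (R : realType) (d : nat) (s : signs d) (x : 'cV[R]_d) :
  flip s (flip s x) = x.
Proof. by apply/colP => i; rewrite !flipE; case: (s i); rewrite ?opprK. Qed.

Lemma flip_shift (R : realType) (d : nat) (s : signs d) (z : 'cV[R]_d) (h : R) :
  flip s (z + const_mx h) = flip s z + h *: sign_vec R s.
Proof.
apply/colP => i; rewrite flipE mxE [in RHS]mxE flipE !mxE.
by case: (s i) => /=; rewrite ?mulr1 // mulrN1 opprD.
Qed.

(** * Averaging along diagonal directions *)

Definition average (R : realType) (d N : nat) (v : 'cV[R]_d)
    (g : 'cV[R]_d -> R) (x : 'cV[R]_d) : R :=
  (\sum_(k < N) g (x + v *+ k)) / N%:R.

(** The product over s in ss of the averaging operators in the directions
    h * s.  Averaging over all signs at once is what allows the same operator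
    to be applied to every component of a decomposition. *)
Definition smooth (R : realType) (d N : nat) (h : R) (ss : seq (signs d))
    (g : 'cV[R]_d -> R) : 'cV[R]_d -> R :=
  foldr (fun s => average N (h *: sign_vec R s)) g ss.

Lemma mean_itv (R : realType) (N : nat) (F : 'I_N -> R) (m M : R) :
  (0 < N)%N -> (forall k, m <= F k <= M) -> m <= (\sum_k F k) / N%:R <= M.
Proof.
move=> N0 FmM; have N0R : 0 < N%:R :> R by rewrite ltr0n.
have sumc (c : R) : c * N%:R = \sum_(k < N) c.
  by rewrite sumr_const card_ord mulr_natr.
rewrite ler_pdivlMr // ler_pdivrMr // !sumc.
by apply/andP; split; apply: ler_sum => k _; have /andP[] := FmM k.
Qed.

(** A one-sided bound on the increments by a fixed vector survives averaging;
    with c = 0 it expresses monotonicity in the direction of - w. *)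
Lemma average_shift (R : realType) (d N : nat) (v w : 'cV[R]_d)
    (g : 'cV[R]_d -> R) (c : R) : (0 < N)%N ->
  (forall x, g (x + w) - g x <= c) ->
  forall x, average N v g (x + w) - average N v g x <= c.
Proof.
move=> N0 gc x; rewrite /average -mulrBl -sumrB ler_pdivrMr ?ltr0n //.
have -> : c * N%:R = \sum_(k < N) c by rewrite sumr_const card_ord mulr_natr.
by apply: ler_sum => k _; rewrite addrAC; exact: gc.
Qed.

(** Translating by the averaging step v leaves only the two end terms
    g (x + N v) - g x of the sum. *)
Lemma average_telescope (R : realType) (d N : nat) (v : 'cV[R]_d)
    (g : 'cV[R]_d -> R) (m M : R) : (0 < N)%N ->
  (forall x, m <= g x <= M) ->
  forall x, average N v g (x + v) - average N v g x <= (M - m) / N%:R.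
Proof.
move=> N0 gmM x; rewrite /average -mulrBl ler_pM2r ?invr_gt0 ?ltr0n //.
rewrite -sumrB.
rewrite (eq_bigr (fun k : 'I_N => g (x + v *+ k.+1) - g (x + v *+ k)));
  last first.
  by move=> k _; rewrite mulrS addrA.
rewrite -(big_mkord xpredT (fun k => g (x + v *+ k.+1) - g (x + v *+ k))).
rewrite telescope_sumr // mulr0n addr0.
by have := gmM x; have := gmM (x + v *+ N); lra.
Qed.

Section Smooth.
Context (R : realType) (d N : nat) (h : R).
Context (N0 : (0 < N)%N) (h0 : 0 <= h).

Lemma smooth_sum (I : finType) (ss : seq (signs d)) (G : I -> 'cV[R]_d -> R) x :
  smooth N h ss (fun x => \sum_i G i x) x = \sum_i smooth N h ss (G i) x.
Proof.
elim: ss x => [//|s ss IH] x.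
rewrite -[LHS]/(average N _ (smooth N h ss _) x) /average.
by rewrite (eq_bigr _ (fun k _ => IH _)) exchange_big /= big_distrl.
Qed.

(** [smooth N h ss g x] is a mean of values of g at points whose distance to x
    is at most (size ss) * N * h.  This serves both for the range of the
    averages of a bounded function and for their closeness to a uniformly
    continuous one. *)
Lemma smooth_itv (ss : seq (signs d)) (g : 'cV[R]_d -> R) (m M : R) x :
  (forall w : 'cV[R]_d, (forall i, `|w i 0| <= (size ss * N)%:R * h) ->
     m <= g (x + w) <= M) ->
  m <= smooth N h ss g x <= M.
Proof.
elim: ss x => [|s ss IH] x /= gmM.
  by rewrite -[x]addr0; apply: gmM => i; rewrite mxE normr0 mul0r.
apply: mean_itv => // k; apply: IH => w hw; rewrite -addrA; apply: gmM => i.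
rewrite mulSn natrD mulrDl mxE (le_trans (ler_normD _ _)) // lerD //.
rewrite mulmxnE !mxE normrMn normrM normrX normrN1 expr1n mulr1.
by rewrite (ger0_norm h0) -[h *+ _]mulr_natl ler_wpM2r // ler_nat ltnW.
Qed.

Lemma smooth_shift (ss : seq (signs d)) (w : 'cV[R]_d) (g : 'cV[R]_d -> R)
    (c : R) :
  (forall x, g (x + w) - g x <= c) ->
  forall x, smooth N h ss g (x + w) - smooth N h ss g x <= c.
Proof. by move=> gc; elim: ss => //= s ss IH; exact: average_shift. Qed.

(** The average in the direction s makes the increment by h * s small, by
    telescoping, and the averages in the other directions preserve this bound.
    For a monotone component, a bound on diagonal increments is a modulus of
    continuity at the scale h. *)
Lemma smooth_step (ss : seq (signs d)) (s : signs d) (g : 'cV[R]_d -> R)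
    (m M : R) :
  s \in ss -> (forall x, m <= g x <= M) -> forall x,
  smooth N h ss g (x + h *: sign_vec R s) - smooth N h ss g x
    <= (M - m) / N%:R.
Proof.
move=> + gmM; elim: ss => //= s' ss IH; rewrite inE.
have [<- _|_ /= /IH] := eqVneq s s'; last exact: average_shift.
by apply: average_telescope => // x; apply: smooth_itv.
Qed.

End Smooth.

(** * Oscillations *)

Lemma oscillation_le (R : realType) (d : nat) (U : set 'cV[R]_d)
    (g : 'cV[R]_d -> R) (m M : R) :
  (forall x, U x -> m <= g x <= M) -> (oscillation U g <= (M - m)%:E)%E.
Proof.
move=> gmM; rewrite EFinB; apply: leeB.
- by apply: ge_ereal_sup => _ [x Ux <-]; rewrite lee_fin;
    have /andP[] := gmM x Ux.
- by apply: le_ereal_inf_tmp => _ [x Ux <-]; rewrite lee_fin;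
    have /andP[] := gmM x Ux.
Qed.

Lemma oscillation_ge (R : realType) (d : nat) (U : set 'cV[R]_d)
    (g : 'cV[R]_d -> R) x y :
  U x -> U y -> ((g x - g y)%:E <= oscillation U g)%E.
Proof.
move=> Ux Uy; rewrite EFinB; apply: leeB.
- by apply: ereal_sup_ubound; exists x.
- by apply: ereal_inf_lbound; exists y.
Qed.

Lemma oscillation_fin (R : realType) (d : nat) (U : set 'cV[R]_d)
    (g : 'cV[R]_d -> R) (c C : R) x0 :
  U x0 -> (forall x, U x -> c <= g x <= C) ->
  exists m M, oscillation U g = (M - m)%:E /\
    (forall x, U x -> m <= g x <= M).
Proof.
move=> Ux0 gcC; rewrite /oscillation.
set S := ereal_sup _; set I := ereal_inf _.
have gS x : U x -> ((g x)%:E <= S)%E.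
  by move=> Ux; apply: ereal_sup_ubound; exists x.
have Ig x : U x -> (I <= (g x)%:E)%E.
  by move=> Ux; apply: ereal_inf_lbound; exists x.
have SC : (S <= C%:E)%E.
  by apply: ge_ereal_sup => _ [x Ux <-]; rewrite lee_fin;
    have /andP[] := gcC x Ux.
have cI : (c%:E <= I)%E.
  by apply: le_ereal_inf_tmp => _ [x Ux <-]; rewrite lee_fin;
    have /andP[] := gcC x Ux.
have Sfin : S \is a fin_num.
  by rewrite fin_numE; have := gS _ Ux0; case: (S) SC.
have Ifin : I \is a fin_num.
  by rewrite fin_numE; have := Ig _ Ux0; case: (I) cI.
exists (fine I), (fine S); split; first by rewrite EFinB !fineK.
by move=> x Ux; rewrite -!lee_fin !fineK // Ig ?gS.
Qed.

Definition box_radius (R : realType) (d : nat) (a b : 'I_d -> R) : R :=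
  \sum_i (`|a i| + `|b i|).

Lemma flip_box_bound (R : realType) (d : nat) (a b : 'I_d -> R)
    (s : signs d) x :
  hyperrectangle a b x -> forall i, `|flip s x i 0| <= box_radius a b.
Proof.
move=> Hx i; have -> : `|flip s x i 0| = `|x i 0|.
  by rewrite flipE; case: (s i); rewrite ?normrN.
have : `|a i| + `|b i| <= box_radius a b.
  rewrite /box_radius (bigD1 i) //= lerDl.
  by apply: sumr_ge0 => j _; rewrite addr_ge0.
apply: le_trans; have := Hx i.
have := ler_norm (- a i); have := ler_norm (b i); rewrite normrN.
have := normr_ge0 (a i); have := normr_ge0 (b i).
by rewrite ler_norml; lra.
Qed.

(** The components of a decomposition are monotone on the whole space, so they
    are bounded on the box by their values at two opposite corners of a cube
    containing all its reflections; hence their oscillations are finite. *)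
Lemma Mdecomposition_oscillation (R : realType) (d : nat) (a b : 'I_d -> R)
    (f : 'cV[R]_d -> R) F : (forall i, a i <= b i) ->
  Mdecomposition (hyperrectangle a b) f F ->
  exists m M : signs d -> R, forall s,
    oscillation (hyperrectangle a b) (fun x => F s (flip s x))
      = (M s - m s)%:E /\
    (forall x, hyperrectangle a b x -> m s <= F s (flip s x) <= M s).
Proof.
move=> hab [Fmono _]; set r := box_radius a b.
have H0 : hyperrectangle a b (\col_i a i) by move=> i; rewrite mxE lexx hab.
have /choice[m /choice[M mMP]] : forall s, exists m M : R,
    oscillation (hyperrectangle a b) (fun x => F s (flip s x)) = (M - m)%:E /\
    (forall x, hyperrectangle a b x -> m <= F s (flip s x) <= M).
  move=> s; apply: (@oscillation_fin _ _ _ _ (F s (const_mx (- r)))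
    (F s (const_mx r)) _ H0) => x Hx; apply/andP; split; apply: Fmono => i;
    rewrite [const_mx _ i 0]mxE; have := flip_box_bound s Hx i;
    by rewrite ler_norml -/r; lra.
by exists m, M.
Qed.

Lemma sumEFin_oscillation (R : realType) (d : nat) (U : set 'cV[R]_d)
    (F : signs d -> 'cV[R]_d -> R) (V : signs d -> R) :
  (forall s, oscillation U (fun x => F s (flip s x)) = (V s)%:E) ->
  (\sum_(s : signs d) oscillation U (fun x => F s (flip s x)))%E
    = (\sum_s V s)%:E.
Proof. by move=> FV; rewrite -sumEFin; apply: eq_bigr. Qed.

(** * Decompositions without large jumps *)

(** The components of any decomposition of a continuous function can be replaced
    by monotone ones with the same bounds and with diagonal increments at most
    1/N of their range, up to a uniform error on f.  The averages are taken in
    the variable x, and only then read in the variable z = flip s x in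
    which the component is nondecreasing. *)
Lemma smooth_decomposition (R : realType) (d : nat) (a b : 'I_d -> R)
    (f : 'cV[R]_d -> R) (F : signs d -> 'cV[R]_d -> R) (m M : signs d -> R)
    (eps : R) (N : nat) :
  (forall i, a i <= b i) ->
  {within hyperrectangle a b, continuous f} ->
  Mdecomposition (hyperrectangle a b) f F ->
  (forall s x, hyperrectangle a b x -> m s <= F s (flip s x) <= M s) ->
  0 < eps -> (0 < N)%N ->
  exists h (g : signs d -> 'cV[R]_d -> R), [/\ 0 < h,
    forall s, vnondecreasing (g s),
    forall s z, m s <= g s z <= M s,
    forall s z, g s (z + const_mx h) - g s z <= (M s - m s) / N%:R &
    forall x, hyperrectangle a b x ->
      `|f x - \sum_s g s (flip s x)| <= eps].
Proof.
move=> hab fcont [Fmono fF] FmM eps0 N0.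
(* The translations have total length (size ss) * N * h = rho. *)
have [rho [rho0 Hrho]] := box_uniformly_continuous fcont eps0.
pose ss := enum (signs d).
have n0 : (0 < size ss * N)%N.
  rewrite muln_gt0 N0 andbT -cardE; apply/card_gt0P.
  by exists [ffun=> false].
have n0R : 0 < (size ss * N)%:R :> R by rewrite ltr0n.
pose h := rho / (size ss * N)%:R; have h0 : 0 < h by rewrite divr_gt0.
have nh : (size ss * N)%:R * h = rho by rewrite mulrC divfK ?gt_eqF.
pose G s x := F s (flip s (clamp a b x)).
have GmM s x : m s <= G s x <= M s by apply: FmM; exact: clamp_box.
exists h, (fun s z => smooth N h ss (G s) (flip s z)); split=> //.
- move=> s y z yz.
  rewrite -subr_le0 -[in flip s y](subrK z y) (addrC _ z).
  have -> : flip s (z + (y - z)) = flip s z + flip s (y - z).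
    by apply/colP => i; rewrite !(flipE, mxE); case: (s i); rewrite ?opprD.
  apply: smooth_shift => // x; rewrite subr_le0; apply: Fmono => i.
  rewrite !flipE; have := yz i; case: ifP => si yzi.
    rewrite lerN2; apply: clamp_le.
    by rewrite mxE flipE si !mxE; lra.
  by apply: clamp_le; rewrite mxE flipE si !mxE; lra.
- by move=> s z; apply: smooth_itv => //; exact: ltW.
- move=> s z; rewrite flip_shift; apply: smooth_step => //; first exact: ltW.
  by rewrite mem_enum.
move=> x Hx.
have -> : \sum_s smooth N h ss (G s) (flip s (flip s x))
    = smooth N h ss (fun x => f (clamp a b x)) x.
  under eq_bigr do rewrite flipK.
  rewrite -smooth_sum; congr (smooth _ _ _ _ _); apply/funext => y.
  by rewrite fF //; exact: clamp_box.
have : f x - eps <= smooth N h ss (fun x => f (clamp a b x)) x <= f x + eps.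
  apply: smooth_itv => //; first exact: ltW.
  move=> w; rewrite nh => wrho.
  have : `|f (clamp a b (x + w)) - f x| <= eps.
    apply: Hrho => //; first exact: clamp_box.
    move=> i; rewrite -{2}(clamp_id Hx).
    apply: (le_trans (clamp_lipschitz _ _ _ _ _)).
    by rewrite mxE addrAC subrr add0r.
  by rewrite ler_norml; lra.
by rewrite ler_norml; lra.
Qed.

(** * From decompositions to networks *)

Lemma constant_block (R : realType) (sigma : R -> R) (L m : nat) (c : R) :
  exists B : mono_block R L m 1, forall z, block_eval sigma B z 0 0 = c.
Proof.
elim: L m => [|L IH] m.
  have A0 : forall i j, 0 <= (0 : 'M[R]_(1, m)) i j by move=> i j; rewrite mxE.
  by exists (Output (const_mx c) A0) => z; rewrite /= mul0mx add0r mxE.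
have A0 : forall i j, 0 <= (0 : 'M[R]_(1, m)) i j by move=> i j; rewrite mxE.
have [B HB] := IH 1%N.
by exists (Hidden 0 (ltn0Sn 0) A0 B) => z; rewrite /= HB.
Qed.

(** One summand for each sign.  The error budget is eps/2 for the averaging, and
    eps/2 for the blocks: 2 V/N <= eps/4 for the steps of the averaged
    components and eps/4 shared equally among the blocks.  The bound on the
    estimated variation has no error term, since each block keeps to the
    interval [m s, M s]. *)
Lemma network_of_decomposition (R : realType) (d : nat) (a b : 'I_d -> R)
    (f : 'cV[R]_d -> R) (F : signs d -> 'cV[R]_d -> R) (m M : signs d -> R)
    (eps : R) (sigma : R -> R) (sm sp : R) (L : nat) :
  (0 < d)%N -> (forall i, a i <= b i) ->
  {within hyperrectangle a b, continuous f} ->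
  Mdecomposition (hyperrectangle a b) f F ->
  (forall s x, hyperrectangle a b x -> m s <= F s (flip s x) <= M s) ->
  0 < eps -> {homo sigma : x y / x <= y} -> sm < sp ->
  sigma x @[x --> -oo] --> sm -> sigma x @[x --> +oo] --> sp ->
  exists eta : networkA R L.+3 d 1,
    (forall x, hyperrectangle a b x ->
       `|f x - net_eval sigma eta x 0 0| <= eps) /\
    (EMVar sigma eta (hyperrectangle a b) <= (\sum_s (M s - m s))%:E)%E.
Proof.
move=> d0 hab fcont dec FmM eps0 hsigma hsmp hsm hsp.
have H0 : hyperrectangle a b (\col_i a i) by move=> i; rewrite mxE lexx hab.
have mM s : 0 <= M s - m s.
  by have /andP[] := FmM s _ H0; rewrite subr_ge0; exact: le_trans.
pose V := \sum_s (M s - m s); have V0 : 0 <= V by apply: sumr_ge0.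
have n0 : (0 < #|signs d|)%N by apply/card_gt0P; exists [ffun=> false].
have n0R : 0 < #|signs d|%:R :> R by rewrite ltr0n.
pose N := (Num.truncn (8 * V / eps)).+1.
have VN : V / N%:R <= eps / 8.
  have : 8 * V / eps <= N%:R by rewrite ltW // truncnS_gt.
  by rewrite ler_pdivrMr ?ltr0n // ler_pdivrMr //; lra.
pose e1 := eps / 4 / #|signs d|%:R.
have e10 : 0 < e1 by rewrite !divr_gt0.
have ne1 : \sum_(s : signs d) e1 = eps / 4.
  by rewrite sumr_const -[e1 *+ _]mulr_natr /e1 divfK ?gt_eqF.
have e20 : 0 < eps / 2 by rewrite divr_gt0.
have [h [g [h0 gmono gmM gstep fg]]] :=
  smooth_decomposition hab fcont dec FmM e20 (ltn0Sn _ : (0 < N)%N).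
have /choice[B HB] := fun s => monotone_network hsigma hsmp hsm hsp L
  (box_radius a b) d0 (gmono s) (gmM s) h0 e10 (gstep s).
pose eta := @NetworkA R L.+3 d 1 _ n0 (fun i => enum_val i)
  (fun i => B (enum_val i)).
exists eta; split=> [x Hx|].
  have -> : net_eval sigma eta x 0 0
      = \sum_s block_eval sigma (B s) (flip s x) 0 0.
    rewrite /net_eval summxE.
    rewrite -(big_enum_val (fun s : signs d =>
      block_eval sigma (B s) (flip s x) 0 0)).
    exact: eq_bigl.
  have : `|\sum_s (g s (flip s x) - block_eval sigma (B s) (flip s x) 0 0)|
      <= \sum_s (2 * ((M s - m s) / N%:R) + e1).
    apply: le_trans (ler_norm_sum _ _ _) _; apply: ler_sum => s _.
    by rewrite distrC; apply: (HB s).2; exact: flip_box_bound.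
  rewrite sumrB [X in _ <= X -> _]big_split /= ne1.
  rewrite -big_distrr -big_distrl /= -/V.
  have := fg x Hx; rewrite !ler_norml.
  set S := \sum_s g s _; set S' := \sum_s block_eval _ _ _ _ _.
  by set W := V / _ in VN *; lra.
rewrite -sumEFin.
have -> : (\sum_(s : signs d) (M s - m s)%:E
    = \sum_(i < #|signs d|) (M (enum_val i) - m (enum_val i))%:E)%E.
  rewrite -(big_enum_val (fun s : signs d => (M s - m s)%:E)).
  exact: eq_bigl.
apply: lee_sum => i _; apply: oscillation_le => x Hx.
exact: (HB _).1.
Qed.

(** * The theorem *)

Lemma MVar_ge (R : realType) (d : nat) (U : set 'cV[R]_d) (f : 'cV[R]_d -> R)
    x y :
  U x -> U y -> ((f x - f y)%:E <= MVar f U)%E.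
Proof.
move=> Ux Uy; apply: le_ereal_inf_tmp => _ [F [_ fF] <-].
rewrite !fF // -sumrB -sumEFin; apply: lee_sum => s _.
exact: (oscillation_ge (fun x => F s (flip s x)) Ux Uy).
Qed.

Theorem theorem3p6 (R : realType) (d : nat) (a b : 'I_d -> R)
  (hab : forall i, a i <= b i)
  (f : 'cV[R]_d -> R)
  (fcont : {within hyperrectangle a b, continuous f})
  (fBMV : BMV (hyperrectangle a b) f)
  (eps : R) (heps : 0 < eps)
  (sigma : R -> R) (hsigma : {homo sigma : x y / x <= y})
  (sm sp : R) (hsmp : sm < sp)
  (hsm : sigma x @[x --> -oo] --> sm)
  (hsp : sigma x @[x --> +oo] --> sp)
  (L : nat) (hL : (3 <= L)%N) :
  exists eta : networkA R L d 1,
    [/\ (ereal_sup [set (`|f x - net_eval sigma eta x 0 0|%R)%:E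
                   | x in hyperrectangle a b] <= eps%:E)%E,
        (EMVar sigma eta (hyperrectangle a b) <= MVar f (hyperrectangle a b))%E
      & (exists x y, [/\ hyperrectangle a b x, hyperrectangle a b y
                       & f x <> f y]) ->
        (EMVar sigma eta (hyperrectangle a b) < MVar f (hyperrectangle a b))%E].
Proof.
set H := hyperrectangle a b in fcont fBMV *.
have H0 : H (\col_i a i) by move=> i; rewrite mxE lexx hab.
have [|fconst] := pselect (exists x y, [/\ H x, H y & f x <> f y]); last first.
  (* A constant f has M-variation 0, so the network must be constant on the
     box as well. *)
  pose x0 : 'cV[R]_d := \col_i a i.
  have [B HB] := constant_block sigma L d (f x0).
  have B0 x : block_eval sigma B x = const_mx (f x0).
    by apply/matrixP => i j; rewrite !ord1 mxE HB.
  pose eta := @NetworkA R L d 1 1 (ltn0Sn 0) (fun=> [ffun=> false]) (fun=> B).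
  exists eta; split=> //.
    apply: ge_ereal_sup => _ [x Hx <-]; rewrite lee_fin.
    rewrite /net_eval big_ord1 /net_summand B0 mxE.
    have -> : f x = f x0 by apply: contra_notP fconst => fx; exists x, x0.
    by rewrite subrr normr0 ltW.
  apply: (@le_trans _ _ 0%E); last first.
    by have := MVar_ge f H0 H0; rewrite subrr.
  rewrite /EMVar big_ord1 -[0%E]/((0 : R)%:E) -(subrr (f x0)).
  by apply: oscillation_le => x _; rewrite /net_summand B0 mxE lexx.
move=> [x1 [y1 [Hx1 Hy1 fxy]]].
have d0 : (0 < d)%N.
  rewrite lt0n; apply: contra_not_neq fxy => d0; congr f.
  by apply/colP => i; have := ltn_ord i; rewrite [X in (_ < X)%N]d0.
have [F0 dec0] := fBMV.
have [m0 [M0 mM0]] := Mdecomposition_oscillation hab dec0.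
pose C := \sum_s (`|m0 s| + `|M0 s|).
have fC x : H x -> `|f x| <= C.
  move=> Hx; rewrite dec0.2 //; apply: le_trans (ler_norm_sum _ _ _) _.
  apply: ler_sum => s _; have [_ /(_ x Hx)] := mM0 s.
  have := ler_norm (- m0 s); have := ler_norm (M0 s); rewrite normrN.
  have := normr_ge0 (m0 s); have := normr_ge0 (M0 s).
  by rewrite ler_norml; lra.
have C0 : 0 <= C by apply: sumr_ge0 => s _; rewrite addr_ge0.
have [mu mu0 muE] : exists2 mu, 0 < mu & MVar f H = mu%:E.
  have fin : (MVar f H <= (\sum_s (M0 s - m0 s))%:E)%E.
    apply: ereal_inf_lbound; exists F0 => //.
    by apply: sumEFin_oscillation => s; have [] := mM0 s.
  have pos : (0 < MVar f H)%E.
    have [fxy'|fxy'|//] := ltgtP (f x1) (f y1).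
      by apply: lt_le_trans (MVar_ge f Hy1 Hx1); rewrite lte_fin subr_gt0.
    by apply: lt_le_trans (MVar_ge f Hx1 Hy1); rewrite lte_fin subr_gt0.
  case E : (MVar f H) fin pos => [mu| |] // _; rewrite lte_fin => mu0.
  by exists mu.
(* theta <= 1/2 keeps 1 - theta positive; the other bound makes
   theta * sup |f| at most eps / 2. *)
pose theta := Num.min 2^-1 (eps / 2 / (C + 1)).
have C1 : 0 < C + 1 by rewrite ltr_wpDl.
have th0 : 0 < theta by rewrite lt_min invr_gt0 ltr0n !divr_gt0.
have th1 : theta <= 2^-1 by rewrite ge_min lexx.
have thC : theta * C <= eps / 2.
  have : theta <= eps / 2 / (C + 1) by rewrite ge_min lexx orbT.
  rewrite ler_pdivlMr // mulrDr mulr1; set W := theta * C; lra.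
have k0 : 0 < 1 - theta by lra.
have : (MVar f H < (mu / (1 - theta))%:E)%E.
  by rewrite muE lte_fin ltr_pdivlMr // gtr_pMr //; lra.
move=> /ereal_inf_lt[_ [F dec <-]].
have [m [M mM]] := Mdecomposition_oscillation hab dec.
rewrite (sumEFin_oscillation (V := fun s => M s - m s)); last first.
  by move=> s; have [] := mM s.
rewrite lte_fin ltr_pdivlMr // mulrC => Vmu.
have dec' : Mdecomposition H (fun x => (1 - theta) * f x)
    (fun s z => (1 - theta) * F s z).
  split=> [s x y xy|x Hx]; first by rewrite ler_pM2l //; exact: dec.1.
  by rewrite dec.2 // big_distrr.
have fcont' : {within H, continuous (fun x => (1 - theta) * f x)}.
  by move=> x; apply: cvgM; [exact: cvg_cst|exact: fcont].
have mM' s x : H x ->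
    (1 - theta) * m s <= (1 - theta) * F s (flip s x) <= (1 - theta) * M s.
  by move=> Hx; rewrite !ler_pM2l //; exact: (mM s).2.
have e20 : 0 < eps / 2 by rewrite divr_gt0.
case: L hL => [|[|[|L]]] // _.
have [eta [near_f small]] := network_of_decomposition L d0 hab fcont'
  dec' mM' e20 hsigma hsmp hsm hsp.
have lt_mu : (EMVar sigma eta H < MVar f H)%E.
  rewrite muE; apply: le_lt_trans small _; rewrite lte_fin.
  by under eq_bigr do rewrite -mulrBr; rewrite -big_distrr.
exists eta; split=> //; last exact: ltW.
apply: ge_ereal_sup => _ [x Hx <-]; rewrite lee_fin.
have := near_f x Hx; set e := net_eval _ _ _ _ _ => fe.
have -> : f x - e = theta * f x + ((1 - theta) * f x - e) by ring.
apply: le_trans (ler_normD _ _) _; rewrite normrM (gtr0_norm th0).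
have : theta * `|f x| <= theta * C by rewrite ler_pM2l // fC.
by set W := theta * C in thC *; set W' := theta * `|f x|; lra.
Qed.
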